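(* Let $S$ be a regular LA-semigroup and let $L_S$ be the set of ideals of $S$. Then $(L_S,\wedge)$ is a semilattice, where $A\wedge B=AB$ for ideals $A,B$ of $S$.
   Context: An LA-semigroup (left almost semigroup) is a set $S$ with a binary operation satisfying the left invertive law $(ab)c=(cb)a$ for all $a,b,c\in S$ (the operation is not assumed associative). $S$ is regular if for each $a\in S$ there exists $x\in S$ such that $a=(ax)a$. For subsets $A,B\subseteq S$, $AB=\{ab: a\in A, b\in B\}$. A subset $I\subseteq S$ is a right (left) ideal if $IS\subseteq I$ ($SI\subseteq I$), and an ideal if it is both. A semilattice is a set with a (well-defined) binary operation that is associative, commutative and idempotent. *)

(* Defs.v *)
From HB Require Import structures.
From mathcomp Require Import all_boot classical_sets.

Set Implicit Arguments.
Unset Strict Implicit.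
Unset Printing Implicit Defensive.

Local Open Scope classical_set_scope.
Local Open Scope group_scope.

HB.mixin Record Magma_isLASemigroup S of Magma S := {
  left_invertive : forall a b c : S, (a * b) * c = (c * b) * a
}.

#[short(type="laSemigroupType")]
HB.structure Definition LASemigroup := {S of Magma_isLASemigroup S & Magma S}.

Definition regular (S : magmaType) : Prop :=
  forall a : S, exists x : S, a = (a * x) * a.

Definition set_mul (S : magmaType) (A B : set S) : set S :=
  [set a * b | a in A & b in B].

(* Since no nonemptiness is required, the empty set is an ideal. *)
Definition right_ideal (S : magmaType) (I : set S) : Prop :=
  set_mul I [set: S] `<=` I.

Definition left_ideal (S : magmaType) (I : set S) : Prop :=
  set_mul [set: S] I `<=` I.

Definition ideal (S : magmaType) (I : set S) : Prop :=
  right_ideal I /\ left_ideal I.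

Definition ideals (S : magmaType) : set (set S) := [set I | ideal I].
Arguments ideals S : clear implicits.

(* [op] is given on all of [T]; the first field says that it restricts to an
   operation on [L], and only its restriction to [L] is constrained. *)
Record is_semilattice (T : Type) (L : set T) (op : T -> T -> T) : Prop := {
  semilattice_closed : forall x y, L x -> L y -> L (op x y);
  semilattice_assoc : forall x y z, L x -> L y -> L z ->
    op x (op y z) = op (op x y) z;
  semilattice_comm : forall x y, L x -> L y -> op x y = op y x;
  semilattice_idem : forall x, L x -> op x x = x
}.

(* Main.v *)
Require Import Defs.
From mathcomp Require Import all_boot classical_sets.

(** Under regularity the product of two ideals is their intersection
    ([regular_set_mulE]): a product always lies in both factors, and an element
    [a = (a * x) * a] common to [A] and [B] is the product of [a * x], which is
    in [A], by [a], which is in [B]. The semilattice laws are therefore those of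
    intersection, and ideals are closed under intersection. *)

Local Open Scope classical_set_scope.

Lemma set_mulS {S : magmaType} {A B C D : set S} :
  A `<=` B -> C `<=` D -> set_mul A C `<=` set_mul B D.
Proof. by move=> AB CD _ [a /AB Ba [c /CD Dc <-]]; exists a => //; exists c. Qed.

Lemma ideal_setI {S : magmaType} {A B : set S} :
  ideal A -> ideal B -> ideal (A `&` B).
Proof.
move=> [rA lA] [rB lB]; split; rewrite /right_ideal /left_ideal subsetI; split.
- exact: subset_trans (set_mulS (@subIsetl _ A B) (@subset_refl _ _)) rA.
- exact: subset_trans (set_mulS (@subIsetr _ A B) (@subset_refl _ _)) rB.
- exact: subset_trans (set_mulS (@subset_refl _ _) (@subIsetl _ A B)) lA.
- exact: subset_trans (set_mulS (@subset_refl _ _) (@subIsetr _ A B)) lB.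
Qed.

Lemma set_mul_subI {S : magmaType} {A B : set S} :
  right_ideal A -> left_ideal B -> set_mul A B `<=` A `&` B.
Proof.
move=> rA lB; rewrite subsetI; split.
- exact: subset_trans (set_mulS (@subset_refl _ _) (@subsetT _ B)) rA.
- exact: subset_trans (set_mulS (@subsetT _ A) (@subset_refl _ _)) lB.
Qed.

(** The inclusion of the intersection in the product is where regularity enters:
    the factorization [a = (a * x) * a] has its left factor in every right ideal
    that contains [a]. *)
Lemma regular_set_mulE {S : magmaType} {A B : set S} :
  regular S -> right_ideal A -> left_ideal B -> set_mul A B = A `&` B.
Proof.
move=> regS rA lB; apply/seteqP; split; first exact: set_mul_subI.
move=> a [Aa Ba]; have [x ax] := regS a.
exists (a * x)%g; first by apply: rA; exists a => //; exists x.
by exists a.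
Qed.

Theorem theorem7 (S : laSemigroupType) (hS : regular S) :
  is_semilattice (ideals S) (@set_mul S).
Proof.
have mulE (A B : set S) : ideal A -> ideal B -> set_mul A B = A `&` B.
  by move=> [rA _] [_ lB]; exact: regular_set_mulE.
split=> [A B iA iB|A B C iA iB iC|A B iA iB|A iA].
- by rewrite mulE //; exact: ideal_setI.
- by rewrite (mulE B C) // (mulE A B) // !mulE ?setIA //; exact: ideal_setI.
- by rewrite !mulE // setIC.
- by rewrite mulE // setIid.
Qed.
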